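(* Let $C$ be a counital coalgebra over a field $k$, let $M$ be a counital $C$-bicomodule, and let $T$ be a subspace of the trivial coalgebra extension $C\ltimes M$. Let $E\subseteq D\subseteq C$, $R\subseteq Q\subseteq M$ and the linear surjection $\eta:D\to Q/R$ with $\mathrm{Ker}(\eta)=E$ be constructed from $T$ as in the context, so that $T=\{(c,m)\in C\ltimes M\mid c\in D,\ m\in Q,\ \eta(c)=m+R\}$. Then $T$ is a subcoalgebra of $C\ltimes M$ if and only if the following hold: (a) $E$ and $D$ are subcoalgebras of $C$ and $\Delta(D)\subseteq E\otimes D+D\otimes E$. (b) $Q$ and $R$ are $C$-subbicomodules of $M$, and $\rho_l(Q)\subseteq E\otimes Q$ and $\rho_r(Q)\subseteq Q\otimes E$, where $\rho_l$ and $\rho_r$ are the left and right $C$-comodule structure maps of $M$. (c) $\eta$ is a $C$-bicomodule homomorphism.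
   Context: Coalgebras are coassociative. Write $\Delta(c)=\sum c_1\otimes c_2$, $\rho_l(m)=\sum m_{(-1)}\otimes m_{(0)}\in C\otimes M$, $\rho_r(m)=\sum m_{(0)}\otimes m_{(1)}\in M\otimes C$. The trivial coalgebra extension $C\ltimes M$ is the vector space $C\oplus M$ with comultiplication $$\Delta(c,m)=\sum(c_1,0)\otimes(c_2,0)+\sum(m_{(-1)},0)\otimes(0,m_{(0)})+\sum(0,m_{(0)})\otimes(m_{(1)},0).$$ For a subspace $T\subseteq C\ltimes M$ put $D=\{c\in C\mid (c,m)\in T\text{ for some }m\in M\}$, $Q=\{m\in M\mid (c,m)\in T\text{ for some }c\in C\}$, $E=\{c\in C\mid (c,0)\in T\}$, $R=\{m\in M\mid (0,m)\in T\}$. Then $E\subseteq D$, $R\subseteq Q$, and $\eta:D\to Q/R\subseteq M/R$, $\eta(c)=m+R$ whenever $(c,m)\in T$, is a well-defined surjective linear map with kernel $E$. A subcoalgebra $D$ of $C$ is a $C$-bicomodule via $\Delta$. *)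

(* Defs.v *)
From HB Require Import structures.
From mathcomp Require Import all_boot all_order all_algebra sesquilinear.
From mathcomp Require Import finmap monalg.
From mathcomp Require Import boolp classical_sets.

Set Implicit Arguments.
Unset Strict Implicit.
Unset Printing Implicit Defensive.

Import GRing.Theory.
Local Open Scope ring_scope.

Section Submodule.
Variables (k : fieldType) (V : lmodType k) (S : submodClosed V).

Record submod : Type := Submod { submod_val : V; _ : submod_val \in S }.

HB.instance Definition _ := [isSub for submod_val].
HB.instance Definition _ := [Choice of submod by <:].
HB.instance Definition _ := [SubChoice_isSubLmodule of submod by <:].

Definition incl : {linear submod -> V} := \val.

Lemma inclP (x : submod) : incl x \in S.
Proof. exact: valP. Qed.

Lemma incl_inj : injective incl.
Proof. exact: val_inj. Qed.

End Submodule.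

Section Quotient.
Variables (k : fieldType) (V : lmodType k) (S : submodClosed V).

Fact submod_oppr_closed : oppr_closed S.
Proof. by move=> x xS; rewrite -scaleN1r rpredZ. Qed.

Definition zmod_of_submod : zmodClosed V :=
  HB.pack (GRing.SubmodClosed.sort S)
    (GRing.isOppClosed.Build V (GRing.SubmodClosed.sort S) submod_oppr_closed).

Definition quomod : Type := Quotient.quot zmod_of_submod.
HB.instance Definition _ := GRing.Zmodule.on quomod.

Let pr (x : V) : quomod := \pi_(Quotient.quot zmod_of_submod)%qT x.

Let prP x y : (pr x = pr y) <-> (x - y \in S).
Proof.
split=> [/eqP|h]; last apply/eqP;
  by rewrite -(@Quotient.idealrBE V zmod_of_submod).
Qed.

Let prK (x : quomod) : pr (repr x) = x.
Proof. exact: reprK. Qed.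

Let prD x y : pr (x + y) = pr x + pr y.
Proof. exact: (@Quotient.pi_add V zmod_of_submod x y). Qed.

Definition quomod_scale (a : k) (x : quomod) : quomod := pr (a *: repr x).

Let prZ a x : quomod_scale a (pr x) = pr (a *: x).
Proof. by apply/prP; rewrite -scalerBr rpredZ //; apply/prP; rewrite prK. Qed.

Fact quomod_scaleA a b x :
  quomod_scale a (quomod_scale b x) = quomod_scale (a * b) x.
Proof. by rewrite -[x]prK !prZ scalerA. Qed.
Fact quomod_scale1 : left_id 1 quomod_scale.
Proof. by move=> x; rewrite -[x]prK prZ scale1r. Qed.
Fact quomod_scaleDr : right_distributive quomod_scale +%R.
Proof. by move=> a x y; rewrite -[x]prK -[y]prK -prD !prZ scalerDr prD. Qed.
Fact quomod_scaleDl x : {morph quomod_scale^~ x : a b / a + b}.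
Proof. by move=> a b; rewrite -[x]prK !prZ scalerDl prD. Qed.

HB.instance Definition _ := GRing.Zmodule_isLmodule.Build k quomod
  quomod_scaleA quomod_scale1 quomod_scaleDr quomod_scaleDl.

Fact pr_linear : linear pr.
Proof. by move=> a x y; rewrite prD -prZ. Qed.
HB.instance Definition _ := GRing.isLinear.Build k V quomod _ pr pr_linear.

Definition qproj : {linear V -> quomod} := pr.

Lemma qprojP x y : (qproj x = qproj y) <-> (x - y \in S).
Proof. exact: prP. Qed.

Lemma qproj_repr (x : quomod) : qproj (repr x) = x.
Proof. exact: prK. Qed.

Lemma qproj_eq0 x : (qproj x = 0) <-> (x \in S).
Proof. by rewrite -(linear0 qproj) qprojP subr0. Qed.

Section Lift.
Variables (U : lmodType k) (f : {linear V -> U}).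
Hypothesis fS : forall x, x \in S -> f x = 0.

Definition qlift_fun (x : quomod) : U := f (repr x).

Fact qlift_funE x : qlift_fun (qproj x) = f x.
Proof.
by apply/eqP; rewrite -subr_eq0 -linearB; apply/eqP/fS/qprojP/qproj_repr.
Qed.

Fact qlift_linear : linear qlift_fun.
Proof.
move=> a x y; rewrite -[x]qproj_repr -[y]qproj_repr -linearP !qlift_funE.
exact: linearP.
Qed.
HB.instance Definition _ :=
  GRing.isLinear.Build k quomod U _ qlift_fun qlift_linear.
Definition qlift : {linear quomod -> U} := qlift_fun.

Lemma qliftE x : qlift (qproj x) = f x.
Proof. exact: qlift_funE. Qed.
End Lift.

End Quotient.

Section Span.
Variables (k : fieldType) (V : lmodType k).

(* The smallest subspace containing A. *)
Definition span (A : set V) : {pred V} :=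
  fun x => `[< forall S : submodClosed V,
                 (forall y, A y -> y \in S) -> x \in S >].

Fact span_submod_closed A : subsemimod_closed (span A).
Proof.
split; first split=> [|x y].
- by apply/asboolP => S _; rewrite rpred0.
- by move=> /asboolP xA /asboolP yA; apply/asboolP => S AS;
     rewrite rpredD ?xA ?yA.
- by move=> a x /asboolP xA; apply/asboolP => S AS; rewrite rpredZ ?xA.
Qed.
HB.instance Definition _ A :=
  GRing.isSubSemiModClosed.Build k V (span A) (span_submod_closed A).

Lemma mem_span (A : set V) x : A x -> x \in span A.
Proof. by move=> Ax; apply/asboolP => S; apply. Qed.

Lemma span_min (A : set V) (S : submodClosed V) :
  (forall x, A x -> x \in S) -> {subset span A <= S}.
Proof. by move=> AS x /asboolP; apply. Qed.

Lemma span_kernel (U : lmodType k) (f : {linear V -> U}) (A : set V) :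
  (forall x, A x -> f x = 0) -> forall x, x \in span A -> f x = 0.
Proof.
move=> fA x.
have kerf : subsemimod_closed (fun x => f x == 0).
  split; first split=> [|y z]; rewrite ?unfold_in ?linear0 //.
    by rewrite linearD => /eqP -> /eqP ->; rewrite addr0.
  by move=> a y; rewrite !unfold_in linearZ => /eqP -> /=; rewrite scaler0.
pose K : submodClosed V := HB.pack (fun x => f x == 0)
  (GRing.isSubSemiModClosed.Build k V (fun x => f x == 0) kerf).
by move=> /(@span_min A K) h; apply/eqP/h => y /fA /eqP.
Qed.

End Span.

Section FreeLift.
Variables (k : fieldType) (I : choiceType) (U : lmodType k) (g : I -> U).

Definition freelift_fun (x : {malg k[I]}) : U :=
  \sum_(i <- msupp x) x@_i *: g i.

Fact freelift_sub (x : {malg k[I]}) (d : {fset I}) :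
  (msupp x `<=` d)%fset -> freelift_fun x = \sum_(i <- d) x@_i *: g i.
Proof.
move=> sub; rewrite /freelift_fun (big_fset_incl _ sub) // => i _ /mcoeff_outdom ->.
by rewrite scale0r.
Qed.

Fact mcoeffZ_ a (x : {malg k[I]}) i : (a *: x)@_i = a * x@_i.
Proof. exact: fgscaleE. Qed.

Fact freelift_linear : linear freelift_fun.
Proof.
move=> a x y; pose d := (msupp (a *: x + y) `|` (msupp x `|` msupp y))%fset.
have sd : (msupp (a *: x + y) `<=` d)%fset by apply: fsubsetUl.
have xd : (msupp x `<=` d)%fset.
  by apply/fsubsetP => i ix; rewrite !inE ix orbT.
have yd : (msupp y `<=` d)%fset.
  by apply/fsubsetP => i iy; rewrite !inE iy !orbT.
rewrite (freelift_sub sd) (freelift_sub xd) (freelift_sub yd).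
rewrite scaler_sumr -big_split /=; apply: eq_bigr => i _.
by rewrite mcoeffD mcoeffZ_ scalerDl scalerA.
Qed.
HB.instance Definition _ :=
  GRing.isLinear.Build k {malg k[I]} U _ freelift_fun freelift_linear.

Definition freelift : {linear {malg k[I]} -> U} := freelift_fun.

Lemma freeliftU i : freelift << i >> = g i.
Proof.
rewrite /freelift /= (@freelift_sub _ [fset i]%fset) ?msuppU_le //.
by rewrite big_seq_fset1 mcoeffUU scale1r.
Qed.
End FreeLift.

(* tp_gen makes tp_lift unique, so this is the usual universal property. *)
Record tensor_product (k : fieldType) (V W : lmodType k) := TensorProduct {
  tp_sort : lmodType k;
  tp_pure : {bilinear V -> W -> tp_sort};
  tp_lift : forall U : lmodType k,
    {bilinear V -> W -> U} -> {linear tp_sort -> U};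
  tp_liftE : forall (U : lmodType k) (f : {bilinear V -> W -> U}) v w,
    tp_lift f (tp_pure v w) = f v w;
  tp_gen : forall t : tp_sort,
    exists s : seq (V * W), t = \sum_(p <- s) tp_pure p.1 p.2 }.

Section FreeTensor.
Variables (k : fieldType) (V W : lmodType k).

Definition tensor_rel : set {malg k[(V * W)%type]} := fun x =>
     (exists a v v' w,
       x = << (a *: v + v', w) >> - (a *: << (v, w) >> + << (v', w) >>))
  \/ (exists a v w w',
       x = << (v, a *: w + w') >> - (a *: << (v, w) >> + << (v, w') >>)).

Definition free_tensor : lmodType k := quomod (span tensor_rel).

Definition free_pure (v : V) (w : W) : free_tensor :=
  qproj (span tensor_rel) << (v, w) >>.

Fact free_pure_bilinear : bilinear_for *:%R *:%R free_pure.
Proof.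
split=> [w a v v'|v a w w']; rewrite /free_pure -linearP; apply/qprojP/mem_span.
  by left; exists a, v, v', w.
by right; exists a, v, w, w'.
Qed.
HB.instance Definition _ := bilinear_isBilinear.Build k V W free_tensor
  *:%R *:%R free_pure free_pure_bilinear.

Fact free_lift_rel (U : lmodType k) (f : {bilinear V -> W -> U}) x :
  tensor_rel x -> freelift (fun p => f p.1 p.2) x = 0.
Proof.
case=> [[a [v [v' [w ->]]]]|[a [v [w [w' ->]]]]];
  rewrite linearB linearP !freeliftU /=.
  by rewrite linearPl subrr.
by rewrite linearPr subrr.
Qed.

Definition free_lift (U : lmodType k) (f : {bilinear V -> W -> U}) :
  {linear free_tensor -> U} := qlift (span_kernel (@free_lift_rel U f)).

Fact free_liftE (U : lmodType k) (f : {bilinear V -> W -> U}) v w :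
  free_lift f (free_pure v w) = f v w.
Proof. by rewrite /free_lift /free_pure qliftE freeliftU. Qed.

Fact free_gen (t : free_tensor) :
  exists s : seq (V * W), t = \sum_(p <- s) free_pure p.1 p.2.
Proof.
rewrite -[t]qproj_repr; set x := repr _; rewrite [x]monalgE linear_sum /=.
exists [seq (x@_p *: p.1, p.2) | p <- msupp x].
rewrite big_map; apply: eq_bigr => p _ /=.
have -> : << x@_p *g p >> = x@_p *: << p >> :> {malg k[(V * W)%type]}.
  by apply/malgP => i; rewrite mcoeffZ_ !mcoeffU mulrnAr mulr1.
by rewrite linearZl_LR linearZ /= /free_pure -surjective_pairing.
Qed.

Definition free_tensor_product : tensor_product V W :=
  TensorProduct free_liftE free_gen.

End FreeTensor.

(* Locked only to keep unification from unfolding the quotient of the free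
   module on V * W. *)
HB.lock Definition the_tensor_product (k : fieldType) (V W : lmodType k) :
  tensor_product V W := free_tensor_product V W.

Section Tensor.
Variables (k : fieldType) (V W : lmodType k).

Definition tensor : lmodType k := tp_sort (the_tensor_product V W).

Definition tens : {bilinear V -> W -> tensor} := tp_pure (the_tensor_product V W).

Definition tlift (U : lmodType k) (f : {bilinear V -> W -> U}) :
  {linear tensor -> U} := tp_lift (the_tensor_product V W) f.

Lemma tliftE (U : lmodType k) (f : {bilinear V -> W -> U}) v w :
  tlift f (tens v w) = f v w.
Proof. exact: tp_liftE. Qed.

Lemma tensorP (t : tensor) :
  exists s : seq (V * W), t = \sum_(p <- s) tens p.1 p.2.
Proof. exact: tp_gen. Qed.

Lemma tensor_ext (U : lmodType k) (f g : {linear tensor -> U}) :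
  (forall v w, f (tens v w) = g (tens v w)) -> f =1 g.
Proof.
move=> fg t; have [s ->] := tensorP t; rewrite !linear_sum.
by apply: eq_bigr => p _; apply: fg.
Qed.

End Tensor.
Arguments tens {k V W}.

Notation "V ⊗ W" := (tensor V%type W%type) (at level 40, left associativity) : type_scope.
Notation "v ⊗ w" := (tens v w) (at level 40, left associativity) : ring_scope.

Section TensorMaps.
Variable k : fieldType.
Implicit Types U V W : lmodType k.

Section Map.
Variables (U V U' V' : lmodType k).
Variables (f : {linear U -> U'}) (g : {linear V -> V'}).

Definition tmap_fun (u : U) (v : V) : U' ⊗ V' := f u ⊗ g v.

Fact tmap_bilinear : bilinear_for *:%R *:%R tmap_fun.
Proof.
by split=> [v a u u'|u a v v']; rewrite /tmap_fun linearP ?linearPl ?linearPr.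
Qed.
HB.instance Definition _ := bilinear_isBilinear.Build k U V (U' ⊗ V')%type
  *:%R *:%R tmap_fun tmap_bilinear.

Definition tmap : {linear (U ⊗ V)%type -> (U' ⊗ V')%type} := tlift tmap_fun.

Lemma tmapE u v : tmap (u ⊗ v) = f u ⊗ g v.
Proof. exact: tliftE. Qed.
End Map.

Section Assoc.
Variables (U V W : lmodType k).

Definition tassoc_in (w : W) (u : U) (v : V) : U ⊗ (V ⊗ W) := u ⊗ (v ⊗ w).

Fact tassoc_in_bilinear w : bilinear_for *:%R *:%R (tassoc_in w).
Proof.
split=> [v a u u'|u a v v']; rewrite /tassoc_in; first by rewrite linearPl.
by rewrite linearPl linearPr.
Qed.
HB.instance Definition _ w := bilinear_isBilinear.Build k U V (U ⊗ (V ⊗ W))%type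
  *:%R *:%R (tassoc_in w) (tassoc_in_bilinear w).

Definition tassoc_out (t : U ⊗ V) (w : W) : U ⊗ (V ⊗ W) :=
  tlift (tassoc_in w) t.

Fact tassoc_out_bilinear : bilinear_for *:%R *:%R tassoc_out.
Proof.
split=> [w a t t'|t a w w']; rewrite /tassoc_out; first by rewrite linearP.
have [s ->] := tensorP t; rewrite !linear_sum /= scaler_sumr -big_split /=.
by apply: eq_bigr => p _; rewrite !tliftE /= /tassoc_in !linearPr.
Qed.
HB.instance Definition _ := bilinear_isBilinear.Build k (U ⊗ V)%type W
  (U ⊗ (V ⊗ W))%type *:%R *:%R tassoc_out tassoc_out_bilinear.

Definition tassoc : {linear (U ⊗ V ⊗ W)%type -> (U ⊗ (V ⊗ W))%type} :=
  tlift tassoc_out.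

Lemma tassocE u v w : tassoc (u ⊗ v ⊗ w) = u ⊗ (v ⊗ w).
Proof. by rewrite tliftE /= /tassoc_out tliftE. Qed.
End Assoc.

Section Unit.
Variable V : lmodType k.

Definition scalel (a : k^o) (v : V) : V := a *: v.
Definition scaler (v : V) (a : k^o) : V := a *: v.

Fact scalel_bilinear : bilinear_for *:%R *:%R scalel.
Proof.
split=> [v a b c|b a v w]; rewrite /scalel; last first.
  by rewrite scalerDr; congr (_ + _); rewrite scalerA mulrC -scalerA.
by rewrite scalerDl; congr (_ + _); apply: esym; apply: scalerA.
Qed.
HB.instance Definition _ :=
  bilinear_isBilinear.Build k k^o V V *:%R *:%R scalel scalel_bilinear.

Fact scaler_bilinear : bilinear_for *:%R *:%R scaler.
Proof.
split=> [b a v w|v a b c]; rewrite /scaler.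
  by rewrite scalerDr; congr (_ + _); rewrite scalerA mulrC -scalerA.
by rewrite scalerDl; congr (_ + _); apply: esym; apply: scalerA.
Qed.
HB.instance Definition _ :=
  bilinear_isBilinear.Build k V k^o V *:%R *:%R scaler scaler_bilinear.

Definition tunitl : {linear (k^o ⊗ V)%type -> V} := tlift scalel.
Definition tunitr : {linear (V ⊗ k^o)%type -> V} := tlift scaler.

Lemma tunitlE a v : tunitl (a ⊗ v) = a *: v. Proof. exact: tliftE. Qed.
Lemma tunitrE v a : tunitr (v ⊗ a) = a *: v. Proof. exact: tliftE. Qed.
End Unit.

Lemma tmap_comp U V U' V' U'' V'' (f : {linear U -> U'}) (g : {linear V -> V'})
    (f' : {linear U' -> U''}) (g' : {linear V' -> V''}) t :
  tmap f' g' (tmap f g t) = tmap (f' \o f) (g' \o g) t.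
Proof.
move: t; apply: (tensor_ext (f := tmap f' g' \o tmap f g)) => u v /=.
by rewrite !tmapE.
Qed.

Lemma eq_tmap U V U' V' (f f' : {linear U -> U'}) (g g' : {linear V -> V'}) :
  f =1 f' -> g =1 g' -> tmap f g =1 tmap f' g'.
Proof. by move=> ff gg; apply: tensor_ext => u v; rewrite !tmapE ff gg. Qed.

Lemma tmap_id U V (t : U ⊗ V) : tmap idfun idfun t = t.
Proof.
by move: t; apply: (tensor_ext (g := idfun)) => u v; rewrite tmapE.
Qed.

Lemma tassoc_nat U V W U' V' W' (f : {linear U -> U'}) (g : {linear V -> V'})
    (h : {linear W -> W'}) t :
  tassoc U' V' W' (tmap (tmap f g) h t) = tmap f (tmap g h) (tassoc U V W t).
Proof.
have [s ->] := tensorP t; rewrite !linear_sum; apply: eq_bigr => -[t' w] _ /=.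
have [s' ->] := tensorP t'.
rewrite linear_sumlz !linear_sum /=; apply: eq_bigr => -[u v] _ /=.
by rewrite !tassocE !tmapE tassocE.
Qed.

End TensorMaps.

Section Retraction.
Variables (k : fieldType) (V : lmodType k) (S : submodClosed V).

Local Open Scope classical_set_scope.

Let disj (X : set V) := (forall a x y, X x -> X y -> X (a *: x + y)) /\
                        (forall x, X x -> x \in S -> x = 0).

Fact complement_exists : exists X, disj X /\
  forall v, exists2 s, s \in S & X (v - s).
Proof.
have [F FP Ftot|X [[Xlin XS] Xmax]] := @Zorn_bigcup V disj.
  split=> [a x y [A FA Ax] [B FB By]|x [A FA Ax]]; last exact: (FP _ FA).2.
  by have [AB|BA] := Ftot _ _ FA FB;
    [exists B|exists A] => //; apply: (FP _ _).1 => //; [apply: AB|apply: BA].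
have X0 : X 0.
  have [//|nX0] := pselect (X 0).
  exfalso; apply: (Xmax [set 0]).
    split=> [x Xx|sub].
      case: nX0; rewrite -(subrr x) -[- x]scaleN1r addrC; exact: Xlin.
    by apply: nX0; apply: sub.
  by split=> [a x y /= -> ->|x /= ->]; rewrite ?scaler0 ?addr0.
have XZ a x : X x -> X (a *: x) by move=> Xx; rewrite -[_ *: _]addr0; apply: Xlin.
exists X; split=> // v; apply: contrapT => nv.
pose Y := [set y | exists a, X (y - a *: v)].
apply: (Xmax Y).
  split=> [x Xx|YX]; first by exists 0; rewrite scale0r subr0.
  apply: nv; exists 0; rewrite ?rpred0 // subr0; apply: YX.
  by exists 1; rewrite scale1r subrr.
split=> [a x y [b Xx] [c Xy]|x [a Xx] xS].
  exists (a * b + c); rewrite scalerDl -scalerA opprD addrACA -scalerBr.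
  exact: Xlin.
have [a0|a0] := eqVneq a 0; first by apply: XS => //; rewrite a0 scale0r subr0 in Xx.
case: nv; exists (a^-1 *: x); rewrite ?rpredZ //.
have -> : v - a^-1 *: x = (- a^-1) *: (x - a *: v); last exact: XZ.
by rewrite scalerBr scalerA !scaleNr mulNr mulVf // scaleN1r opprK addrC.
Qed.

(* Subspaces of vector spaces are direct summands. *)
Lemma retraction_exists : exists r : {linear V -> submod S}, cancel (incl S) r.
Proof.
have [X [[Xlin XS] XV]] := complement_exists.
pose r v : submod S := let: exist2 s sS _ := cid2 (XV v) in Submod sS.
have rX v : X (v - \val (r v)) by rewrite /r; case: cid2.
have X0 : X 0 by have := Xlin (-1) _ _ (rX 0) (rX 0); rewrite scaleN1r addNr.
have rE v (s : submod S) : X (v - \val s) -> r v = s.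
  move=> Xs; apply: val_inj; apply/eqP; rewrite -subr_eq0; apply/eqP/XS.
    have -> : \val (r v) - \val s = (-1) *: (v - \val (r v)) + (v - \val s).
      by rewrite scaleN1r opprB addrA subrK.
    exact: Xlin.
  by apply: rpredD; [|apply: submod_oppr_closed]; apply: valP.
have r_lin : linear r.
  move=> a x y; apply: rE; rewrite linearP /= addrACA -scalerDr.
  exact: Xlin.
pose rL := GRing.isLinear.Build k V (submod S) _ r r_lin.
exists (HB.pack r rL : {linear V -> submod S}) => s /=.
by apply: rE; rewrite subrr.
Qed.

Definition retr : {linear V -> submod S} := projT1 (cid retraction_exists).

Lemma retrK : cancel (incl S) retr.
Proof. by rewrite /retr; case: cid. Qed.

Lemma incl_retr v : v \in S -> incl S (retr v) = v.
Proof. by move=> vS; rewrite -[v]/(incl S (Submod vS)) retrK. Qed.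

End Retraction.

HB.mixin Record isCoalgebra (k : fieldType) C of GRing.Lmodule k C := {
  comul : {linear C -> (C ⊗ C)%type};
  counit : {linear C -> k^o};
  comulA : forall c : C,
    tassoc C C C (tmap comul idfun (comul c)) = tmap idfun comul (comul c);
  counitl : forall c : C, tunitl C (tmap counit idfun (comul c)) = c;
  counitr : forall c : C, tunitr C (tmap idfun counit (comul c)) = c }.

#[short(type="coalgType")]
HB.structure Definition Coalgebra (k : fieldType) :=
  {C of GRing.Lmodule k C & isCoalgebra k C}.

HB.mixin Record isBicomodule (k : fieldType) (C : coalgType k) M
    of GRing.Lmodule k M := {
  lcoact : {linear M -> (C ⊗ M)%type};
  rcoact : {linear M -> (M ⊗ C)%type};
  lcoactA : forall m : M,
    tassoc C C M (tmap comul idfun (lcoact m)) = tmap idfun lcoact (lcoact m);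
  rcoactA : forall m : M,
    tassoc M C C (tmap rcoact idfun (rcoact m)) = tmap idfun comul (rcoact m);
  lrcoactA : forall m : M,
    tassoc C M C (tmap lcoact idfun (rcoact m)) = tmap idfun rcoact (lcoact m);
  lcoact_counit : forall m : M, tunitl M (tmap counit idfun (lcoact m)) = m;
  rcoact_counit : forall m : M, tunitr M (tmap idfun counit (rcoact m)) = m }.

#[short(type="bicomodType")]
HB.structure Definition Bicomodule (k : fieldType) (C : coalgType k) :=
  {M of GRing.Lmodule k M & isBicomodule k C M}.

Definition bicomod_hom (k : fieldType) (C : coalgType k) (X Y : bicomodType C)
    (f : {linear X -> Y}) : Prop :=
  (forall x, lcoact (f x) = tmap idfun f (lcoact x)) /\
  (forall x, rcoact (f x) = tmap f idfun (rcoact x)).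

Definition regular (k : fieldType) (C : coalgType k) : bicomodType C :=
  HB.pack (Coalgebra.sort C) (isBicomodule.Build k C (Coalgebra.sort C)
    (@comulA k C) (@comulA k C) (@comulA k C) (@counitl k C) (@counitr k C)).


Lemma idfunK (T : Type) : cancel (@idfun T) (@idfun T).
Proof. by []. Qed.

Section TensorMore.
Variable k : fieldType.
Implicit Types U V W : lmodType k.

Lemma tmapK U V U' V' (f : {linear U -> U'}) (g : {linear V -> V'})
    (f' : {linear U' -> U}) (g' : {linear V' -> V}) :
  cancel f f' -> cancel g g' -> cancel (tmap f g) (tmap f' g').
Proof.
move=> ff gg t; rewrite tmap_comp -[RHS]tmap_id.
by apply: eq_tmap => x /=; rewrite ?ff ?gg.
Qed.

Lemma tunitl_nat U V (f : {linear U -> V}) t :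
  tunitl V (tmap idfun f t) = f (tunitl U t).
Proof.
move: t; apply: (tensor_ext (f := tunitl V \o tmap idfun f) (g := f \o tunitl U)).
by move=> a u /=; rewrite tmapE !tunitlE linearZ.
Qed.

Lemma tunitr_nat U V (f : {linear U -> V}) t :
  tunitr V (tmap f idfun t) = f (tunitr U t).
Proof.
move: t; apply: (tensor_ext (f := tunitr V \o tmap f idfun) (g := f \o tunitr U)).
by move=> a u /=; rewrite tmapE !tunitrE linearZ.
Qed.

(* The image of A ⊗ B in V ⊗ W; over a field it is a copy of A ⊗ B. *)
Definition subtensor V W (A : submodClosed V) (B : submodClosed W) :
  set (V ⊗ W) := range (tmap (incl A) (incl B)).

Lemma subtensorP V W (A : submodClosed V) (B : submodClosed W) t :
  subtensor A B t <->
  exists2 s : seq (V * W), all (fun p => (p.1 \in A) && (p.2 \in B)) s &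
    t = \sum_(p <- s) p.1 ⊗ p.2.
Proof.
split=> [[u _ <-]|[s]].
  have [s ->] := tensorP u; rewrite linear_sum /=.
  exists [seq (incl A p.1, incl B p.2) | p <- s].
    by apply/allP => _ /mapP[p _ ->] /=; rewrite !inclP.
  by rewrite big_map; apply: eq_bigr => p _; rewrite tmapE.
elim: s t => [|[v w] s IHs] t /=; first by move=> _ ->; exists 0; rewrite ?linear0 ?big_nil.
case/andP=> /andP[vA wB] /IHs /(_ erefl) [u _ us] ->.
exists (Submod vA ⊗ Submod wB + u) => //.
by rewrite linearD tmapE us big_cons.
Qed.

End TensorMore.

Section Transport.
Variables (k : fieldType) (C : coalgType k) (X Y : lmodType k).
Variables (l : {linear X -> (C ⊗ X)%type}) (r : {linear X -> (X ⊗ C)%type}).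
Variables (l' : {linear Y -> (C ⊗ Y)%type}) (r' : {linear Y -> (Y ⊗ C)%type}).
Variable j : {linear X -> Y}.
Hypothesis lj : forall x, l' (j x) = tmap idfun j (l x).
Hypothesis rj : forall x, r' (j x) = tmap j idfun (r x).

Fact transport_lA1 x : tassoc C C Y (tmap comul idfun (l' (j x))) =
  tmap idfun (tmap idfun j) (tassoc C C X (tmap comul idfun (l x))).
Proof.
rewrite lj -tassoc_nat !tmap_comp; congr (tassoc _ _ _ _).
by apply: eq_tmap => y //=; rewrite tmap_id.
Qed.

Fact transport_lA2 x : tmap idfun l' (l' (j x)) =
  tmap idfun (tmap idfun j) (tmap idfun l (l x)).
Proof. by rewrite lj !tmap_comp; apply: eq_tmap => y //=; rewrite lj. Qed.

Fact transport_rA1 x : tassoc Y C C (tmap r' idfun (r' (j x))) =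
  tmap j (tmap idfun idfun) (tassoc X C C (tmap r idfun (r x))).
Proof.
rewrite rj -tassoc_nat !tmap_comp; congr (tassoc _ _ _ _).
by apply: eq_tmap => y //=; rewrite rj.
Qed.

Fact transport_rA2 x : tmap idfun comul (r' (j x)) =
  tmap j (tmap idfun idfun) (tmap idfun (@comul k C) (r x)).
Proof. by rewrite rj !tmap_comp; apply: eq_tmap => y //=; rewrite tmap_id. Qed.

Fact transport_lrA1 x : tassoc C Y C (tmap l' idfun (r' (j x))) =
  tmap idfun (tmap j idfun) (tassoc C X C (tmap l idfun (r x))).
Proof.
rewrite rj -tassoc_nat !tmap_comp; congr (tassoc _ _ _ _).
by apply: eq_tmap => y //=; rewrite lj.
Qed.

Fact transport_lrA2 x : tmap idfun r' (l' (j x)) =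
  tmap idfun (tmap j idfun) (tmap idfun r (l x)).
Proof. by rewrite lj !tmap_comp; apply: eq_tmap => y //=; rewrite rj. Qed.

Fact transport_lc x : tunitl Y (tmap (@counit k C) idfun (l' (j x))) =
  j (tunitl X (tmap counit idfun (l x))).
Proof.
by rewrite lj -tunitl_nat !tmap_comp; congr (tunitl _ _); apply: eq_tmap.
Qed.

Fact transport_rc x : tunitr Y (tmap idfun (@counit k C) (r' (j x))) =
  j (tunitr X (tmap idfun counit (r x))).
Proof.
by rewrite rj -tunitr_nat !tmap_comp; congr (tunitr _ _); apply: eq_tmap.
Qed.

End Transport.

Definition subcoalgebra (k : fieldType) (C : coalgType k)
    (S : submodClosed C) : Prop :=
  forall c, c \in S -> subtensor S S (comul c).

Definition subbicomodule (k : fieldType) (C : coalgType k) (M : bicomodType C)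
    (N : submodClosed M) : Prop :=
  forall m, m \in N -> range (tmap (@idfun C) (incl N)) (lcoact m) /\
                       range (tmap (incl N) (@idfun C)) (rcoact m).

Section SubBicomodule.
Variables (k : fieldType) (C : coalgType k) (M : bicomodType C).
Variable (N : submodClosed M).

(* For x in N, lcoact x lies in the image of C ⊗ N in C ⊗ M (hypothesis hN
   below), where tmap idfun (retr N) inverts tmap idfun (incl N); hence the
   chosen retraction does not matter, see sub_lcoactE and sub_rcoactE. *)
Definition sub_lcoact : {linear submod N -> (C ⊗ submod N)%type} :=
  tmap idfun (retr N) \o lcoact \o incl N.
Definition sub_rcoact : {linear submod N -> (submod N ⊗ C)%type} :=
  tmap (retr N) idfun \o rcoact \o incl N.

Hypothesis hN : subbicomodule N.

Fact sub_lcoactE x : lcoact (incl N x) = tmap idfun (incl N) (sub_lcoact x).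
Proof.
have [[t _ tx] _] := hN (inclP x).
by rewrite /sub_lcoact /= -tx (tmapK (@idfunK C) (@retrK _ _ N)).
Qed.

Fact sub_rcoactE x : rcoact (incl N x) = tmap (incl N) idfun (sub_rcoact x).
Proof.
have [_ [t _ tx]] := hN (inclP x).
by rewrite /sub_rcoact /= -tx (tmapK (@retrK _ _ N) (@idfunK C)).
Qed.

Let lE := sub_lcoactE.
Let rE := sub_rcoactE.
Let iK := @retrK k M N.

Fact sub_lcoactA x : tassoc C C _ (tmap comul idfun (sub_lcoact x)) =
  tmap idfun sub_lcoact (sub_lcoact x).
Proof.
apply: (can_inj (tmapK (@idfunK C) (tmapK (@idfunK C) iK))).
by rewrite -(transport_lA1 lE) -(transport_lA2 lE) lcoactA.
Qed.

Fact sub_rcoactA x : tassoc _ C C (tmap sub_rcoact idfun (sub_rcoact x)) =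
  tmap idfun comul (sub_rcoact x).
Proof.
apply: (can_inj (tmapK iK (tmapK (@idfunK C) (@idfunK C)))).
by rewrite -(transport_rA1 rE) -(transport_rA2 rE) rcoactA.
Qed.

Fact sub_lrcoactA x : tassoc C _ C (tmap sub_lcoact idfun (sub_rcoact x)) =
  tmap idfun sub_rcoact (sub_lcoact x).
Proof.
apply: (can_inj (tmapK (@idfunK C) (tmapK iK (@idfunK C)))).
by rewrite -(transport_lrA1 lE rE) -(transport_lrA2 lE rE) lrcoactA.
Qed.

Fact sub_lcoact_counit x : tunitl _ (tmap (@counit k C) idfun (sub_lcoact x)) = x.
Proof. by apply: incl_inj; rewrite -(transport_lc lE) lcoact_counit. Qed.

Fact sub_rcoact_counit x : tunitr _ (tmap idfun (@counit k C) (sub_rcoact x)) = x.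
Proof. by apply: incl_inj; rewrite -(transport_rc rE) rcoact_counit. Qed.

Definition sub_bicomod : bicomodType C := HB.pack (submod N)
  (isBicomodule.Build k C (submod N) sub_lcoactA sub_rcoactA sub_lrcoactA
    sub_lcoact_counit sub_rcoact_counit).

Lemma incl_bicomod_hom : bicomod_hom (incl N : {linear sub_bicomod -> M}).
Proof. by split; [apply: sub_lcoactE|apply: sub_rcoactE]. Qed.

End SubBicomodule.

Section QuotientBicomodule.
Variables (k : fieldType) (C : coalgType k) (M : bicomodType C).
Variable (N : submodClosed M).
Hypothesis hN : subbicomodule N.

Fact quo_lcoact_ker m : m \in N -> (tmap idfun (qproj N) \o lcoact) m = 0 :> C ⊗ _.
Proof.
move=> /hN [[t _ /= <-] _]; rewrite tmap_comp.
move: t; apply: (tensor_ext (g := \0)) => c n /=.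
by rewrite tmapE /= (qproj_eq0 _ _).2 ?inclP ?linear0r.
Qed.

Fact quo_rcoact_ker m : m \in N -> (tmap (qproj N) idfun \o rcoact) m = 0 :> _ ⊗ C.
Proof.
move=> /hN [_ [t _ /= <-]]; rewrite tmap_comp.
move: t; apply: (tensor_ext (g := \0)) => n c /=.
by rewrite tmapE /= (qproj_eq0 _ _).2 ?inclP ?linear0l.
Qed.

Definition quo_lcoact : {linear quomod N -> (C ⊗ quomod N)%type} :=
  qlift quo_lcoact_ker.
Definition quo_rcoact : {linear quomod N -> (quomod N ⊗ C)%type} :=
  qlift quo_rcoact_ker.

Fact quo_lcoactE m : quo_lcoact (qproj N m) = tmap idfun (qproj N) (lcoact m).
Proof. exact: qliftE. Qed.
Fact quo_rcoactE m : quo_rcoact (qproj N m) = tmap (qproj N) idfun (rcoact m).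
Proof. exact: qliftE. Qed.

Let lE := quo_lcoactE.
Let rE := quo_rcoactE.

Fact quo_lcoactA x : tassoc C C _ (tmap comul idfun (quo_lcoact x)) =
  tmap idfun quo_lcoact (quo_lcoact x).
Proof.
by rewrite -[x]qproj_repr (transport_lA1 lE) (transport_lA2 lE) lcoactA.
Qed.

Fact quo_rcoactA x : tassoc _ C C (tmap quo_rcoact idfun (quo_rcoact x)) =
  tmap idfun comul (quo_rcoact x).
Proof.
by rewrite -[x]qproj_repr (transport_rA1 rE) (transport_rA2 rE) rcoactA.
Qed.

Fact quo_lrcoactA x : tassoc C _ C (tmap quo_lcoact idfun (quo_rcoact x)) =
  tmap idfun quo_rcoact (quo_lcoact x).
Proof.
by rewrite -[x]qproj_repr (transport_lrA1 lE rE) (transport_lrA2 lE rE) lrcoactA.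
Qed.

Fact quo_lcoact_counit x : tunitl _ (tmap (@counit k C) idfun (quo_lcoact x)) = x.
Proof. by rewrite -[x]qproj_repr (transport_lc lE) lcoact_counit. Qed.

Fact quo_rcoact_counit x : tunitr _ (tmap idfun (@counit k C) (quo_rcoact x)) = x.
Proof. by rewrite -[x]qproj_repr (transport_rc rE) rcoact_counit. Qed.

Definition quo_bicomod : bicomodType C := HB.pack (quomod N)
  (isBicomodule.Build k C (quomod N) quo_lcoactA quo_rcoactA quo_lrcoactA
    quo_lcoact_counit quo_rcoact_counit).

Lemma qproj_bicomod_hom : bicomod_hom (qproj N : {linear M -> quo_bicomod}).
Proof. by split; [apply: quo_lcoactE|apply: quo_rcoactE]. Qed.

End QuotientBicomodule.

Section TrivialExtension.
Variables (k : fieldType) (C : coalgType k) (M : bicomodType C).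

Definition triv_ext : Type := (C * M)%type.
HB.instance Definition _ := GRing.Lmodule.copy triv_ext (C * M)%type.

Definition inC_fun (c : C) : triv_ext := (c, 0).
Definition inM_fun (m : M) : triv_ext := (0, m).

Fact inC_linear : linear inC_fun.
Proof. by move=> a c c'; apply: injective_projections; rewrite /= ?scaler0 ?addr0. Qed.
Fact inM_linear : linear inM_fun.
Proof. by move=> a m m'; apply: injective_projections; rewrite /= ?scaler0 ?addr0. Qed.
HB.instance Definition _ := GRing.isLinear.Build k C triv_ext _ inC_fun inC_linear.
HB.instance Definition _ := GRing.isLinear.Build k M triv_ext _ inM_fun inM_linear.

Definition inC : {linear C -> triv_ext} := inC_fun.
Definition inM : {linear M -> triv_ext} := inM_fun.

Lemma triv_extE (x : triv_ext) : x = inC x.1 + inM x.2.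
Proof. by case: x => c m; apply: injective_projections; rewrite /= ?addr0 ?add0r. Qed.

Definition text_comul_fun (x : triv_ext) : triv_ext ⊗ triv_ext :=
  tmap inC inC (comul x.1) + tmap inC inM (lcoact x.2)
  + tmap inM inC (rcoact x.2).

Definition text_counit_fun (x : triv_ext) : k^o := counit x.1.

Fact text_comul_linear : linear text_comul_fun.
Proof.
move=> a x y; rewrite /text_comul_fun /= !linearP !scalerDr /=.
by rewrite [RHS]addrACA [X in _ = X + _]addrACA.
Qed.
Fact text_counit_linear : linear text_counit_fun.
Proof. by move=> a x y; rewrite /text_counit_fun linearP. Qed.
HB.instance Definition _ := GRing.isLinear.Build k triv_ext
  (triv_ext ⊗ triv_ext)%type _ text_comul_fun text_comul_linear.
HB.instance Definition _ := GRing.isLinear.Build k triv_ext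
  k^o _ text_counit_fun text_counit_linear.

Definition text_comul : {linear triv_ext -> (triv_ext ⊗ triv_ext)%type} :=
  text_comul_fun.
Definition text_counit : {linear triv_ext -> k^o} := text_counit_fun.

Fact text_comulC c : text_comul (inC c) = tmap inC inC (comul c).
Proof. by rewrite /text_comul /= /text_comul_fun /= !linear0 !addr0. Qed.
Fact text_comulM m : text_comul (inM m) =
  tmap inC inM (lcoact m) + tmap inM inC (rcoact m).
Proof. by rewrite /text_comul /= /text_comul_fun /= !linear0 !add0r. Qed.

Fact tmapDl (U V U' V' : lmodType k) (h f f' : {linear U -> U'})
    (g : {linear V -> V'}) t :
  (forall u, h u = f u + f' u) -> tmap h g t = tmap f g t + tmap f' g t.
Proof.
move=> hE; have [s ->] := tensorP t; rewrite !linear_sum -big_split /=.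
by apply: eq_bigr => p _; rewrite !tmapE hE linearDl.
Qed.

Fact tmapDr (U V U' V' : lmodType k) (f : {linear U -> U'})
    (h g g' : {linear V -> V'}) t :
  (forall v, h v = g v + g' v) -> tmap f h t = tmap f g t + tmap f g' t.
Proof.
move=> hE; have [s ->] := tensorP t; rewrite !linear_sum -big_split /=.
by apply: eq_bigr => p _; rewrite !tmapE hE linearDr.
Qed.

Fact text_comulA x :
  tassoc _ _ _ (tmap text_comul idfun (text_comul x)) =
  tmap idfun text_comul (text_comul x).
Proof.
have comulC (V V' : lmodType k) (g : {linear V -> V'}) t :
    tmap (text_comul \o inC) g t = tmap (tmap inC inC) g (tmap comul idfun t).
  by rewrite tmap_comp; apply: eq_tmap => y //=; rewrite text_comulC.
have comulM (V V' : lmodType k) (g : {linear V -> V'}) t : tmap (text_comul \o inM) g t =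
    tmap (tmap inC inM) g (tmap lcoact idfun t)
    + tmap (tmap inM inC) g (tmap rcoact idfun t).
  rewrite (@tmapDl _ _ _ _ _ (tmap inC inM \o lcoact) (tmap inM inC \o rcoact)).
    by rewrite !tmap_comp; congr (_ + _); apply: eq_tmap.
  by move=> m /=; rewrite text_comulM.
have comulC' (V V' : lmodType k) (g : {linear V -> V'}) t :
    tmap g (text_comul \o inC) t = tmap g (tmap inC inC) (tmap idfun comul t).
  by rewrite tmap_comp; apply: eq_tmap => y //=; rewrite text_comulC.
have comulM' (V V' : lmodType k) (g : {linear V -> V'}) t : tmap g (text_comul \o inM) t =
    tmap g (tmap inC inM) (tmap idfun lcoact t)
    + tmap g (tmap inM inC) (tmap idfun rcoact t).
  rewrite (@tmapDr _ _ _ _ _ _ (tmap inC inM \o lcoact) (tmap inM inC \o rcoact)).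
    by rewrite !tmap_comp; congr (_ + _); apply: eq_tmap.
  by move=> m /=; rewrite text_comulM.
have lE (V V' : lmodType k) (f : {linear V -> triv_ext}) (g : {linear V' -> triv_ext}) t :
    tmap text_comul idfun (tmap f g t) = tmap (text_comul \o f) g t.
  by rewrite tmap_comp; apply: eq_tmap.
have rE (V V' : lmodType k) (f : {linear V -> triv_ext}) (g : {linear V' -> triv_ext}) t :
    tmap idfun text_comul (tmap f g t) = tmap f (text_comul \o g) t.
  by rewrite tmap_comp; apply: eq_tmap.
rewrite [x]triv_extE (linearD text_comul) text_comulC text_comulM.
rewrite !(linearD (tmap _ _)) !linearD; congr (_ + _).
  by rewrite lE rE comulC comulC' tassoc_nat comulA.
rewrite !lE !rE comulC comulM comulC' comulM' linearD !tassoc_nat.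
by rewrite lcoactA rcoactA lrcoactA addrA.
Qed.

Fact text_counitl x :
  tunitl _ (tmap text_counit idfun (text_comul x)) = x.
Proof.
have lE (V V' : lmodType k) (f : {linear V -> triv_ext}) (g : {linear V' -> triv_ext}) t :
    tmap text_counit idfun (tmap f g t)
    = tmap idfun g (tmap (text_counit \o f) idfun t).
  by rewrite !tmap_comp; apply: eq_tmap.
have c0 (V : lmodType k) (t : M ⊗ V) : tmap (text_counit \o inM) idfun t = 0.
  move: t; apply: (tensor_ext (g := \0)) => m v /=.
  by rewrite tmapE /= /text_counit_fun /= linear0 linear0l.
have cC (V : lmodType k) (t : C ⊗ V) : tmap (text_counit \o inC) idfun t = tmap counit idfun t.
  exact: eq_tmap.
rewrite {2}[x]triv_extE [in LHS](triv_extE x) (linearD text_comul) text_comulC text_comulM.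
rewrite !linearD !lE !tunitl_nat c0 !cC !linear0 addr0.
by rewrite counitl lcoact_counit.
Qed.

Fact text_counitr x :
  tunitr _ (tmap idfun text_counit (text_comul x)) = x.
Proof.
have lE (V V' : lmodType k) (f : {linear V -> triv_ext}) (g : {linear V' -> triv_ext}) t :
    tmap idfun text_counit (tmap f g t)
    = tmap f idfun (tmap idfun (text_counit \o g) t).
  by rewrite !tmap_comp; apply: eq_tmap.
have c0 (V : lmodType k) (t : V ⊗ M) : tmap idfun (text_counit \o inM) t = 0.
  move: t; apply: (tensor_ext (g := \0)) => v m /=.
  by rewrite tmapE /= /text_counit_fun /= linear0 linear0r.
have cC (V : lmodType k) (t : V ⊗ C) : tmap idfun (text_counit \o inC) t = tmap idfun counit t.
  exact: eq_tmap.
rewrite {2}[x]triv_extE [in LHS](triv_extE x) (linearD text_comul) text_comulC text_comulM.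
rewrite !linearD !lE !tunitr_nat c0 !cC !linear0 add0r.
by rewrite counitr rcoact_counit.
Qed.

HB.instance Definition _ := isCoalgebra.Build k triv_ext
  text_comulA text_counitl text_counitr.

End TrivialExtension.

Section FromSubspace.
Variables (k : fieldType) (C : coalgType k) (M : bicomodType C).
Variable T : submodClosed (triv_ext M).

(* The subspaces D, Q of first and second components of elements of T, and the
   subspaces E, R of those c and m with (c, 0) and (0, m) in T. *)
Definition spD : {pred C} := fun c => `[< exists m : M, (c, m) \in T >].
Definition spQ : {pred M} := fun m => `[< exists c : C, (c, m) \in T >].
Definition spE : {pred C} := fun c => (c, 0) \in T.
Definition spR : {pred M} := fun m => (0, m) \in T.

Let TZ a (x : triv_ext M) : x \in T -> a *: x \in T.
Proof. exact: rpredZ. Qed.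

Fact spD_closed : subsemimod_closed spD.
Proof.
split; first split=> [|c c' /asboolP[m cm] /asboolP[m' cm']].
- by apply/asboolP; exists 0; apply: rpred0.
- by apply/asboolP; exists (m + m'); apply: (rpredD cm cm').
- move=> a c /asboolP[m cm]; apply/asboolP; exists (a *: m).
  exact: (TZ a cm).
Qed.
Fact spQ_closed : subsemimod_closed spQ.
Proof.
split; first split=> [|m m' /asboolP[c cm] /asboolP[c' cm']].
- by apply/asboolP; exists 0; apply: rpred0.
- by apply/asboolP; exists (c + c'); apply: (rpredD cm cm').
- move=> a m /asboolP[c cm]; apply/asboolP; exists (a *: c).
  exact: (TZ a cm).
Qed.
Fact spE_closed : subsemimod_closed spE.
Proof.
split; first split=> [|c c' cT cT']; first exact: (rpred0 T).
- rewrite -[_ \in _]/(inC M (c + c') \in T) linearD; exact: rpredD.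
- move=> a c cT; rewrite -[_ \in _]/(inC M (a *: c) \in T) linearZ_LR.
  exact: TZ.
Qed.
Fact spR_closed : subsemimod_closed spR.
Proof.
split; first split=> [|m m' mT mT']; first exact: (rpred0 T).
- rewrite -[_ \in _]/(inM M (m + m') \in T) linearD; exact: rpredD.
- move=> a m mT; rewrite -[_ \in _]/(inM M (a *: m) \in T) linearZ_LR.
  exact: TZ.
Qed.
HB.instance Definition _ := GRing.isSubSemiModClosed.Build k C spD spD_closed.
HB.instance Definition _ := GRing.isSubSemiModClosed.Build k M spQ spQ_closed.
HB.instance Definition _ := GRing.isSubSemiModClosed.Build k C spE spE_closed.
HB.instance Definition _ := GRing.isSubSemiModClosed.Build k M spR spR_closed.

(* Q / R, realised as the image of Q in M / R. *)
Definition spQR : {pred quomod spR} :=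
  fun x => `[< exists2 m, m \in spQ & x = qproj spR m >].

Fact spQR_closed : subsemimod_closed spQR.
Proof.
split; first split=> [|x y /asboolP[m mQ ->] /asboolP[m' mQ' ->]].
- by apply/asboolP; exists 0; rewrite ?rpred0 ?linear0.
- by apply/asboolP; exists (m + m'); rewrite ?linearD ?rpredD.
- move=> a x /asboolP[m mQ ->]; apply/asboolP.
  by exists (a *: m); rewrite ?linearZ ?rpredZ.
Qed.
HB.instance Definition _ :=
  GRing.isSubSemiModClosed.Build k (quomod spR) spQR spQR_closed.

Fact eta_ex (c : submod spD) :
  exists y : submod spQR,
    forall m, (incl spD c, m) \in T -> incl spQR y = qproj spR m.
Proof.
have /asboolP[m cm] := inclP c.
have yQR : qproj spR m \in spQR.
  by apply/asboolP; exists m => //; apply/asboolP; exists (incl spD c).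
exists (Submod yQR) => m' cm'; apply/qprojP.
rewrite /in_mem /= /spR.
have -> : (0, m - m') = (incl spD c, m) - (incl spD c, m') :> triv_ext M.
  by apply: injective_projections; rewrite /= ?subrr.
by apply: rpredD => //; apply: submod_oppr_closed.
Qed.

(* Any m with (c, m) in T gives the same class in M / R, see eta_ex. *)
Definition eta_fun (c : submod spD) : submod spQR := projT1 (cid (eta_ex c)).

Lemma eta_funE c m (cm : (incl spD c, m) \in T) :
  incl spQR (eta_fun c) = qproj spR m.
Proof. by rewrite /eta_fun; case: cid => /= y; apply. Qed.

Fact eta_linear : linear eta_fun.
Proof.
move=> a c c'; have /asboolP[m cm] := inclP c; have /asboolP[m' cm'] := inclP c'.
apply: incl_inj; rewrite linearP (eta_funE cm) (eta_funE cm') -linearP.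
apply: eta_funE; rewrite linearP.
exact: (rpredD (TZ a cm) cm').
Qed.
HB.instance Definition _ := GRing.isLinear.Build k (submod spD) (submod spQR) _
  eta_fun eta_linear.

Definition eta : {linear submod spD -> submod spQR} := eta_fun.

Lemma etaE c m : (incl spD c, m) \in T -> incl spQR (eta c) = qproj spR m.
Proof. exact: eta_funE. Qed.

Lemma eta_surj y : exists c, eta c = y.
Proof.
have /asboolP[m /asboolP[c cm] ym] := inclP y.
have cD : c \in spD by apply/asboolP; exists m.
by exists (Submod cD); apply: incl_inj; rewrite ym (etaE (m := m)).
Qed.

Lemma eta_ker c : eta c = 0 <-> incl spD c \in spE.
Proof.
have /asboolP[m cm] := inclP c.
have -> : eta c = 0 <-> m \in spR.
  rewrite -(qproj_eq0 spR) -(etaE cm).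
  by split=> [->|h]; [rewrite linear0|apply: incl_inj; rewrite h linear0].
rewrite /in_mem /= /spR /spE.
have {}cm : inC M (incl spD c) + inM M m \in T.
  by rewrite -(triv_extE (incl spD c, m)).
split=> h.
  rewrite -[_ \in T]/(inC M (incl spD c) \in T) -(addrK (inM M m) (inC M _)).
  by apply: rpredD => //; apply: submod_oppr_closed.
rewrite -[_ \in T]/(inM M m \in T) -(addKr (inC M (incl spD c)) (inM M m)).
by apply: rpredD => //; apply: submod_oppr_closed.
Qed.

Lemma mem_from_subspace c m : ((c, m) : triv_ext M) \in T <->
  exists2 d : submod spD, incl spD d = c &
    m \in spQ /\ incl spQR (eta d) = qproj spR m.
Proof.
split=> [cm|[d <- [mQ]]].
  have cD : c \in spD by apply/asboolP; exists m.
  exists (Submod cD) => //; split; first by apply/asboolP; exists c.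
  exact: etaE.
have /asboolP[m' dm'] := inclP d; rewrite (etaE dm') => /qprojP.
rewrite /in_mem /= /spR => h.
have -> : (incl spD d, m) = (incl spD d, m') - (0, m' - m) :> triv_ext M.
  by apply: injective_projections; rewrite /= ?subr0 // opprB addrC subrK.
by apply: rpredD => //; apply: submod_oppr_closed.
Qed.

End FromSubspace.
Arguments spQR {k C M} T _.

Fact subcoalgebra_regular (k : fieldType) (C : coalgType k) (D : submodClosed C) :
  subcoalgebra D -> subbicomodule (D : submodClosed (regular C)).
Proof.
move=> hD c /hD [t _ tc].
have l : tmap idfun (incl D) (tmap (incl D) idfun t) = comul c.
  by rewrite -tc tmap_comp; apply: eq_tmap.
have r : tmap (incl D) idfun (tmap idfun (incl D) t) = comul c.
  by rewrite -tc tmap_comp; apply: eq_tmap.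
by split; [exists (tmap (incl D) idfun t)|exists (tmap idfun (incl D) t)].
Qed.

(* D with the bicomodule structure given by restricting comul. *)
Definition subcoalgebra_bicomod (k : fieldType) (C : coalgType k)
    (D : submodClosed C) (hD : subcoalgebra D) : bicomodType C :=
  sub_bicomod (subcoalgebra_regular hD).

Section SubquotientBicomodule.
Variables (k : fieldType) (C : coalgType k) (M : bicomodType C).
Variable T : submodClosed (triv_ext M).
Hypotheses (hQ : subbicomodule (spQ T)) (hR : subbicomodule (spR T)).

Fact spQR_subbicomodule :
  subbicomodule (spQR T : submodClosed (quo_bicomod hR)).
Proof.
pose QR := spQR T : submodClosed _; pose R := spR T : submodClosed _.
pose p : {linear submod (spQ T) -> submod QR} :=
  retr QR \o (qproj R \o incl (spQ T)).
have pE q : incl QR (p q) = qproj R (incl (spQ T) q).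
  by apply: incl_retr; apply/asboolP; exists (incl (spQ T) q); rewrite ?inclP.
move=> x /asboolP[m mQ ->]; have [[t _ tm] [u _ um]] := hQ mQ.
split.
  exists (tmap idfun p t) => //; rewrite (qproj_bicomod_hom hR).1 -tm !tmap_comp.
  by apply: eq_tmap => y //=; apply: pE.
exists (tmap p idfun u) => //; rewrite (qproj_bicomod_hom hR).2 -um !tmap_comp.
by apply: eq_tmap => y //=; apply: pE.
Qed.

Definition subquotient_bicomod : bicomodType C := sub_bicomod spQR_subbicomodule.

End SubquotientBicomodule.

(* Main.v *)
(* Let p : T -> C and q : T -> M be the projections. Their kernels are the
   copies of R and E in T. Since (q ⊗ q) kills Δ(T) ⊆ T ⊗ T, Δ(T) lies in E ⊗
   T + T ⊗ E, and (a)-(c) follow by applying p and q on each side, using η p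
   = π q with π : M -> M/R. Conversely, lift η to a linear s : D -> Q and put
   σ d = (d, s d), which lies in T. If Δ(c) = a + b with a in E ⊗ D and b in
   D ⊗ E, then for (c, m) in T the element Δ(c, m) - (id ⊗ σ) a - (σ ⊗ id) b
   is the sum of ρ_l(m) - (id ⊗ s) a and ρ_r(m) - (s ⊗ id) b; as η is a
   bicomodule map and vanishes on E, id ⊗ π and π ⊗ id kill these, so they
   lie in E ⊗ R and R ⊗ E, hence in T ⊗ T. *)
From HB Require Import structures.
From mathcomp Require Import boolp sesquilinear.
Require Import Defs.
From mathcomp Require Import all_boot all_order all_algebra classical_sets.

Set Implicit Arguments.
Unset Strict Implicit.
Unset Printing Implicit Defensive.

Import GRing.Theory.
Local Open Scope ring_scope.
Local Open Scope classical_set_scope.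

(** * Linear quasi-inverses on a subspace *)

Section QuasiInverse.
Variables (k : fieldType) (V U : lmodType k) (f : {linear V -> U}).
Variable S : submodClosed V.

Definition image_sub : {pred U} := fun u => `[< exists2 v, v \in S & u = f v >].
Definition ker_sub : {pred V} := fun v => (v \in S) && (f v == 0).

Fact image_sub_closed : subsemimod_closed image_sub.
Proof.
split; first split=> [|_ _ /asboolP[v vS ->] /asboolP[w wS ->]].
- by apply/asboolP; exists 0; rewrite ?rpred0 ?linear0.
- by apply/asboolP; exists (v + w); rewrite ?rpredD ?linearD.
- move=> a _ /asboolP[v vS ->]; apply/asboolP.
  by exists (a *: v); rewrite ?rpredZ ?linearZ.
Qed.
HB.instance Definition _ :=
  GRing.isSubSemiModClosed.Build k U image_sub image_sub_closed.

Fact ker_sub_closed : subsemimod_closed ker_sub.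
Proof.
split; first split=> [|v w /andP[vS /eqP fv] /andP[wS /eqP fw]].
- by apply/andP; rewrite rpred0 linear0.
- by apply/andP; rewrite rpredD // linearD fv fw addr0.
- move=> a v /andP[vS /eqP fv]; apply/andP.
  by rewrite rpredZ // linearZ fv /= scaler0.
Qed.
HB.instance Definition _ :=
  GRing.isSubSemiModClosed.Build k V ker_sub ker_sub_closed.

(** As [g] is linear on all of [U], it can be a factor of [tmap]; as its values lie in [S],
    [idfun \- (g \o f)] maps [S] into the kernel of [f] on [S]. *)
Lemma quasi_inverse : exists g : {linear U -> V},
  (forall u, g u \in S) /\ {in S, forall v, f (g (f v)) = f v}.
Proof.
(* h projects S onto a complement of the kernel of f, on which f is injective,
   so h of any preimage depends linearly on its image. *)
pose h v := v - incl ker_sub (retr ker_sub v).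
have hB v w : h (v - w) = h v - h w.
  by rewrite /h !linearB /= addrACA.
have hK v : v \in ker_sub -> h v = 0.
  by move=> vK; rewrite /h incl_retr ?subrr.
have kP v : (incl ker_sub (retr ker_sub v) \in S) /\
            f (incl ker_sub (retr ker_sub v)) = 0.
  by have /andP[? /eqP] := inclP (retr ker_sub v).
have pre u : exists2 v, v \in S & incl image_sub (retr image_sub u) = f v.
  by have /asboolP[v ? ?] := inclP (retr image_sub u); exists v.
pose g u := h (s2val (cid2 (pre u))).
have gS u : g u \in S.
  rewrite /g; case: cid2 => v vS _ /=.
  by apply: rpredD => //; apply: submod_oppr_closed; case: (kP v).
(* Two preimages in [S] of one vector differ by an element of [ker_sub], which [h] kills; so the
   choice made by [cid2] does not matter. *)
have gE u v : v \in S -> incl image_sub (retr image_sub u) = f v -> g u = h v.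
  move=> vS uv; rewrite /g; case: cid2 => w wS uw /=.
  have /hK : w - v \in ker_sub.
    apply/andP; split; first by apply: rpredD => //; apply: submod_oppr_closed.
    by rewrite linearB -uw -uv subrr.
  by rewrite hB => /eqP; rewrite subr_eq0 => /eqP.
have g_lin : linear g.
  move=> a u w; have [v vS uv] := pre u; have [v' vS' wv'] := pre w.
  rewrite (gE _ _ vS uv) (gE _ _ vS' wv') (gE _ (a *: v + v')).
  - by rewrite /h !linearP /= addrACA -scalerDr.
  - by rewrite rpredD ?rpredZ.
  - by rewrite !linearP uv wv'.
pose gL := GRing.isLinear.Build k U V _ g g_lin.
exists (HB.pack g gL : {linear U -> V}); split=> [u|v vS] /=; first exact: gS.
rewrite (gE _ v vS) ?/h ?linearB ?(kP v).2 ?subr0 // incl_retr //.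
by apply/asboolP; exists v.
Qed.

End QuasiInverse.

(** * Images and kernels in tensor products of subspaces *)

Section Subtensor.
Variable k : fieldType.
Implicit Types V W : lmodType k.

Lemma subtensorD V W (A : submodClosed V) (B : submodClosed W) t u :
  subtensor A B t -> subtensor A B u -> subtensor A B (t + u).
Proof. by move=> [t' _ <-] [u' _ <-]; exists (t' + u'); rewrite ?linearD. Qed.

Lemma subtensorB V W (A : submodClosed V) (B : submodClosed W) t u :
  subtensor A B t -> subtensor A B u -> subtensor A B (t - u).
Proof. by move=> [t' _ <-] [u' _ <-]; exists (t' - u'); rewrite ?linearB. Qed.

(** Composing with the retractions turns [f] and [g] into maps between the subspaces themselves;
    their tensor product supplies the witness. *)
Lemma subtensor_tmap V W V' W' (A : submodClosed V) (B : submodClosed W)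
    (A' : submodClosed V') (B' : submodClosed W')
    (f : {linear V -> V'}) (g : {linear W -> W'}) t :
  {in A, forall v, f v \in A'} -> {in B, forall w, g w \in B'} ->
  subtensor A B t -> subtensor A' B' (tmap f g t).
Proof.
move=> fA gB [u _ <-].
exists (tmap (retr A' \o f \o incl A) (retr B' \o g \o incl B) u) => //.
rewrite !tmap_comp; apply: eq_tmap => x /=.
  by apply: incl_retr; apply/fA/inclP.
by apply: incl_retr; apply/gB/inclP.
Qed.

Lemma eq_in_tmap V W V' W' (A : submodClosed V) (B : submodClosed W)
    (f f' : {linear V -> V'}) (g g' : {linear W -> W'}) t :
  {in A, f =1 f'} -> {in B, g =1 g'} -> subtensor A B t ->
  tmap f g t = tmap f' g' t.
Proof.
move=> ff gg [u _ <-]; rewrite !tmap_comp; apply: eq_tmap => x /=.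
  by apply/ff/inclP.
by apply/gg/inclP.
Qed.

Lemma subtensor_rangel V W (A : submodClosed V) (B : submodClosed W) t :
  subtensor A B t -> range (tmap idfun (incl B)) t.
Proof.
move=> [u _ <-]; exists (tmap (incl A) idfun u) => //.
by rewrite tmap_comp; apply: eq_tmap.
Qed.

Lemma subtensor_ranger V W (A : submodClosed V) (B : submodClosed W) t :
  subtensor A B t -> range (tmap (incl A) idfun) t.
Proof.
move=> [u _ <-]; exists (tmap idfun (incl B) u) => //.
by rewrite tmap_comp; apply: eq_tmap.
Qed.

Lemma tmap0l V W V' W' (f : {linear V -> V'}) (g : {linear W -> W'}) :
  f =1 \0 -> tmap f g =1 \0.
Proof.
by move=> f0; apply: (tensor_ext (g := \0)) => v w /=; rewrite tmapE f0 linear0l.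
Qed.

Lemma tmap0r V W V' W' (f : {linear V -> V'}) (g : {linear W -> W'}) :
  g =1 \0 -> tmap f g =1 \0.
Proof.
by move=> g0; apply: (tensor_ext (g := \0)) => v w /=; rewrite tmapE g0 linear0r.
Qed.

Lemma tmapBl V W V' W' (f f' : {linear V -> V'}) (g : {linear W -> W'}) t :
  tmap (f \- f') g t = tmap f g t - tmap f' g t.
Proof.
apply/eqP; rewrite eq_sym subr_eq; apply/eqP; apply: tmapDl => v /=.
by rewrite subrK.
Qed.

Lemma tmapBr V W V' W' (f : {linear V -> V'}) (g g' : {linear W -> W'}) t :
  tmap f (g \- g') t = tmap f g t - tmap f g' t.
Proof.
apply/eqP; rewrite eq_sym subr_eq; apply/eqP; apply: tmapDr => v /=.
by rewrite subrK.
Qed.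

(* With a quasi-inverse g of f on A, the projection id - g f maps A into K and
   fixes t. *)
Lemma subtensor_kerl V W V' (A K : submodClosed V) (B : submodClosed W)
    (f : {linear V -> V'}) t :
  {in A, forall v, f v = 0 -> v \in K} ->
  subtensor A B t -> tmap f (@idfun W) t = 0 -> subtensor K B t.
Proof.
move=> AK tAB ft; have [g [gA fgf]] := quasi_inverse f A.
have -> : t = tmap (idfun \- (g \o f)) idfun t.
  rewrite tmapBl tmap_id -[LHS]subr0; congr (_ - _).
  have -> : tmap (g \o f) (@idfun W) t = tmap g (@idfun W) (tmap f (@idfun W) t).
    by rewrite tmap_comp; apply: eq_tmap.
  by rewrite ft linear0.
apply: subtensor_tmap tAB => // v vA /=; apply: AK.
  by apply: rpredD => //; apply: submod_oppr_closed.
by rewrite linearB fgf ?subrr.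
Qed.

Lemma subtensor_kerr V W W' (A : submodClosed V) (B K : submodClosed W)
    (f : {linear W -> W'}) t :
  {in B, forall w, f w = 0 -> w \in K} ->
  subtensor A B t -> tmap (@idfun V) f t = 0 -> subtensor A K t.
Proof.
move=> BK tAB ft; have [g [gB fgf]] := quasi_inverse f B.
have -> : t = tmap idfun (idfun \- (g \o f)) t.
  rewrite tmapBr tmap_id -[LHS]subr0; congr (_ - _).
  have -> : tmap (@idfun V) (g \o f) t = tmap (@idfun V) g (tmap (@idfun V) f t).
    by rewrite tmap_comp; apply: eq_tmap.
  by rewrite ft linear0.
apply: subtensor_tmap tAB => // v vB /=; apply: BK.
  by apply: rpredD => //; apply: submod_oppr_closed.
by rewrite linearB fgf ?subrr.
Qed.

(** With p = [f' \o f] and q = [g' \o g], the identity is (id - p) ⊗ id + p ⊗ (id - q) + p ⊗ q. The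
    last term factors through f ⊗ g and kills [t]; the first two send [t] into K ⊗ B and A ⊗ L. *)
Lemma subtensor_ker V W V' W' (A K : submodClosed V) (B L : submodClosed W)
    (f : {linear V -> V'}) (g : {linear W -> W'}) t :
  {in A, forall v, f v = 0 -> v \in K} -> {in B, forall w, g w = 0 -> w \in L} ->
  subtensor A B t -> tmap f g t = 0 ->
  [set x + y | x in subtensor K B & y in subtensor A L] t.
Proof.
move=> AK BL tAB fgt.
have [f' [fA fK]] := quasi_inverse f A; have [g' [gB gK]] := quasi_inverse g B.
exists (tmap (idfun \- (f' \o f)) idfun t).
  apply: subtensor_tmap tAB => // v vA /=; apply: AK.
    by apply: rpredD => //; apply: submod_oppr_closed.
  by rewrite linearB fK ?subrr.
exists (tmap (f' \o f) (idfun \- (g' \o g)) t).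
  apply: subtensor_tmap tAB => [v vA|w wB] /=; first exact: fA.
  apply: BL; first by apply: rpredD => //; apply: submod_oppr_closed.
  by rewrite linearB gK ?subrr.
rewrite tmapBl tmapBr tmap_id -(tmap_comp f g) fgt linear0 subr0.
exact: subrK.
Qed.

End Subtensor.

(** * Projections of the trivial extension and its comultiplication *)

Section TrivialExtensionProjections.
Variables (k : fieldType) (C : coalgType k) (M : bicomodType C).

Definition outC_fun (x : triv_ext M) : C := x.1.
Definition outM_fun (x : triv_ext M) : M := x.2.
Fact outC_linear : linear outC_fun. Proof. by []. Qed.
Fact outM_linear : linear outM_fun. Proof. by []. Qed.
HB.instance Definition _ :=
  GRing.isLinear.Build k (triv_ext M) C _ outC_fun outC_linear.
HB.instance Definition _ :=
  GRing.isLinear.Build k (triv_ext M) M _ outM_fun outM_linear.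
Definition outC : {linear triv_ext M -> C} := outC_fun.
Definition outM : {linear triv_ext M -> M} := outM_fun.

Lemma outCK : cancel (inC M) outC. Proof. by []. Qed.
Lemma outMK : cancel (inM M) outM. Proof. by []. Qed.
Lemma outC_inM m : outC (inM M m) = 0. Proof. by []. Qed.
Lemma outM_inC c : outM (inC M c) = 0. Proof. by []. Qed.

(** Separates the three summands of the comultiplication, so that for each pair of projections below
    only the surviving ones have to be read off. *)
Lemma tmap_comul_ext (V W : lmodType k) (f : {linear triv_ext M -> V})
    (g : {linear triv_ext M -> W}) (x : triv_ext M) :
  tmap f g (comul x) = tmap (f \o inC M) (g \o inC M) (comul (outC x))
    + tmap (f \o inC M) (g \o inM M) (lcoact (outM x))
    + tmap (f \o inM M) (g \o inC M) (rcoact (outM x)).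
Proof.
rewrite -[comul x]/(tmap (inC M) (inC M) (comul (outC x))
  + tmap (inC M) (inM M) (lcoact (outM x))
  + tmap (inM M) (inC M) (rcoact (outM x))).
by rewrite !linearD !tmap_comp.
Qed.

Lemma tmap_outCC (x : triv_ext M) : tmap outC outC (comul x) = comul (outC x).
Proof.
rewrite tmap_comul_ext (tmap0r _ (g := outC \o inM M)) //.
by rewrite (tmap0l (f := outC \o inM M)) // !addr0 -[RHS]tmap_id; apply: eq_tmap.
Qed.

Lemma tmap_outCM (x : triv_ext M) : tmap outC outM (comul x) = lcoact (outM x).
Proof.
rewrite tmap_comul_ext (tmap0r _ (g := outM \o inC M)) //.
rewrite (tmap0l (f := outC \o inM M)) // add0r addr0 -[RHS]tmap_id.
exact: eq_tmap.
Qed.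

Lemma tmap_outMC (x : triv_ext M) : tmap outM outC (comul x) = rcoact (outM x).
Proof.
rewrite tmap_comul_ext (tmap0l (f := outM \o inC M)) //.
rewrite (tmap0l (f := outM \o inC M)) // !add0r -[RHS]tmap_id.
exact: eq_tmap.
Qed.

(** No summand of Δ has both factors in M. The containments in E ⊗ D + D ⊗ E, E ⊗ Q and Q ⊗ E all
    rest on this vanishing. *)
Lemma tmap_outMM (x : triv_ext M) : tmap outM outM (comul x) = 0.
Proof.
rewrite tmap_comul_ext (tmap0l (f := outM \o inC M)) //.
rewrite (tmap0l (f := outM \o inC M)) // !add0r.
exact: (tmap0r _ (g := outM \o inC M)).
Qed.

End TrivialExtensionProjections.

(** * The bicomodule condition on η, expressed over M/R *)

Section EtaHom.
Variables (k : fieldType) (C : coalgType k) (M : bicomodType C).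
Variable T : submodClosed (triv_ext M).
Let D : submodClosed C := spD T.
Let E : submodClosed C := spE T.
Let Q : submodClosed M := spQ T.
Let R : submodClosed M := spR T.

Lemma outC_spD : {in T, forall x, outC M x \in D}.
Proof. by move=> [c m] xT; apply/asboolP; exists m. Qed.

Lemma outM_spQ : {in T, forall x, outM M x \in Q}.
Proof. by move=> [c m] xT; apply/asboolP; exists c. Qed.

Lemma outM0_spE : {in T, forall x, outM M x = 0 -> outC M x \in E}.
Proof. by move=> [c m] xT; rewrite /outM /= /outM_fun /= => m0; rewrite m0 in xT. Qed.

Lemma outC0_spR : {in T, forall x, outC M x = 0 -> outM M x \in R}.
Proof. by move=> [c m] xT; rewrite /outC /= /outC_fun /= => c0; rewrite c0 in xT. Qed.

(* Only meaningful on D: the chosen retraction onto D extends eta to all of C. *)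
Definition eta_ambient : {linear C -> quomod R} :=
  incl (spQR T) \o eta T \o retr D.

Lemma eta_ambientE x : x \in T -> eta_ambient (outC M x) = qproj R (outM M x).
Proof.
move=> xT; have cD := outC_spD xT.
rewrite -[LHS]/(incl (spQR T) (eta T (retr D (outC M x)))); apply: etaE.
by rewrite incl_retr // -surjective_pairing.
Qed.

Hypotheses (hD : subcoalgebra D) (hQ : subbicomodule Q) (hR : subbicomodule R).

(** Trades the structures on D and Q/R, which are built from retractions, for identities in C ⊗ M/R
    and M/R ⊗ C. Nothing is lost, since the inclusion of Q/R has a left inverse and stays injective
    after tensoring with C. *)
Lemma bicomod_hom_etaP : bicomod_hom
    (eta T : {linear subcoalgebra_bicomod hD -> subquotient_bicomod hQ hR}) <->
  forall x, x \in T ->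
    tmap idfun (qproj R) (lcoact (outM M x)) =
      tmap idfun eta_ambient (comul (outC M x)) /\
    tmap (qproj R) idfun (rcoact (outM M x)) =
      tmap eta_ambient idfun (comul (outC M x)).
Proof.
have hQR := @spQR_subbicomodule _ _ _ _ hQ hR.
have hDr := subcoalgebra_regular hD.
have [pl pr] := qproj_bicomod_hom hR.
have iE d x : x \in T -> incl D d = outC M x ->
    incl (spQR T) (eta T d) = qproj R (outM M x).
  by move=> xT dx; rewrite -(eta_ambientE xT) -dx /= retrK.
have iK := @retrK _ _ (spQR T).
have ambK (d : submod D) : incl (spQR T) (eta T d) = eta_ambient (incl D d).
  by rewrite /= retrK.
have lE d x : x \in T -> incl D d = outC M x ->
    sub_lcoact (spQR T : submodClosed (quo_bicomod hR)) (eta T d) =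
      tmap idfun (eta T) (sub_lcoact (D : submodClosed (regular C)) d) <->
    tmap idfun (qproj R) (lcoact (outM M x)) =
      tmap idfun eta_ambient (comul (outC M x)).
  move=> xT dx; rewrite -pl -(iE d x xT dx) (sub_lcoactE hQR) -dx.
  have -> : tmap idfun eta_ambient (comul (incl D d)) =
      tmap idfun (incl (spQR T))
        (tmap idfun (eta T) (sub_lcoact (D : submodClosed (regular C)) d)).
    (* Here [comul] is read as the left coaction of [regular C], which restricts to D. *)
    rewrite [comul _](sub_lcoactE hDr d) !tmap_comp.
    by apply: eq_tmap => // y; apply/esym/ambK.
  split=> [->//|]; exact: (can_inj (tmapK (@idfunK C) iK)).
have rE d x : x \in T -> incl D d = outC M x ->
    sub_rcoact (spQR T : submodClosed (quo_bicomod hR)) (eta T d) =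
      tmap (eta T) idfun (sub_rcoact (D : submodClosed (regular C)) d) <->
    tmap (qproj R) idfun (rcoact (outM M x)) =
      tmap eta_ambient idfun (comul (outC M x)).
  move=> xT dx; rewrite -pr -(iE d x xT dx) (sub_rcoactE hQR) -dx.
  have -> : tmap eta_ambient idfun (comul (incl D d)) =
      tmap (incl (spQR T)) idfun
        (tmap (eta T) idfun (sub_rcoact (D : submodClosed (regular C)) d)).
    rewrite [comul _](sub_rcoactE hDr d) !tmap_comp.
    by apply: eq_tmap => // y; apply/esym/ambK.
  split=> [->//|]; exact: (can_inj (tmapK iK (@idfunK C))).
split=> [[hl hr] x xT|h].
  have dx : incl D (retr D (outC M x)) = outC M x.
    exact/incl_retr/outC_spD.
  by split; [apply/(lE _ _ xT dx)/hl|apply/(rE _ _ xT dx)/hr].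
(* Every element of D is the first component of a point of [T], so identities indexed by [T] cover
   all of D. *)
have ex (d : submod D) : exists2 x, x \in T & incl D d = outC M x.
  by have /asboolP[m cm] := inclP d; exists (incl D d, m).
split=> d; have [x xT dx] := ex d.
  exact/(lE _ _ xT dx)/(h x xT).1.
exact/(rE _ _ xT dx)/(h x xT).2.
Qed.

End EtaHom.

(** * Conditions (a)-(c) for a subcoalgebra *)

Section ComponentsOfSubcoalgebra.
Variables (k : fieldType) (C : coalgType k) (M : bicomodType C).
Variable T : submodClosed (triv_ext M).
Let D : submodClosed C := spD T.
Let E : submodClosed C := spE T.
Let Q : submodClosed M := spQ T.
Let R : submodClosed M := spR T.
Hypothesis hT : subcoalgebra T.

(** [K] is the copy of E in [T], and [L] is the copy of R. *)
Let K : submodClosed (triv_ext M) := ker_sub (outM M) T.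
Let L : submodClosed (triv_ext M) := ker_sub (outC M) T.

Let TK : {in T, forall x, outM M x = 0 -> x \in K}.
Proof. by move=> x xT x0; apply/andP; rewrite x0. Qed.
Let TL : {in T, forall x, outC M x = 0 -> x \in L}.
Proof. by move=> x xT x0; apply/andP; rewrite x0. Qed.
Let KE : {in K, forall x, outC M x \in E}.
Proof. by move=> x /andP[xT /eqP x0]; apply: outM0_spE. Qed.
Let LR : {in L, forall x, outM M x \in R}.
Proof. by move=> x /andP[xT /eqP x0]; apply: outC0_spR. Qed.
Let K0 : {in K, outM M =1 \0}.
Proof. by move=> x /andP[_ /eqP]. Qed.

Lemma subcoalgebra_comul_ker x : x \in T ->
  [set u + v | u in subtensor K T & v in subtensor T K] (comul x).
Proof. by move=> xT; apply: subtensor_ker (hT xT) (tmap_outMM x). Qed.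

Lemma subcoalgebra_comul_spD x : x \in T ->
  [set u + v | u in subtensor E D & v in subtensor D E] (comul (outC M x)).
Proof.
move=> /subcoalgebra_comul_ker[u uK [v vK uv]].
exists (tmap (outC M) (outC M) u).
  by apply: subtensor_tmap uK; last exact: outC_spD.
exists (tmap (outC M) (outC M) v).
  by apply: subtensor_tmap vK; first exact: outC_spD.
by rewrite -linearD uv tmap_outCC.
Qed.

Lemma subcoalgebra_lcoact_spQ x :
  x \in T -> subtensor E Q (lcoact (outM M x)).
Proof.
move=> /subcoalgebra_comul_ker[u uK [v vK uv]].
(* The summand [v] in T ⊗ K disappears because [outM] vanishes on [K]. *)
rewrite -tmap_outCM -uv linearD (eq_in_tmap (t := v) (fun _ _ => erefl) K0 vK).
rewrite (tmap0r _ (g := \0)) // addr0.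
by apply: subtensor_tmap uK; last exact: outM_spQ.
Qed.

Lemma subcoalgebra_rcoact_spQ x :
  x \in T -> subtensor Q E (rcoact (outM M x)).
Proof.
move=> /subcoalgebra_comul_ker[u uK [v vK uv]].
rewrite -tmap_outMC -uv linearD (eq_in_tmap (t := u) K0 (fun _ _ => erefl) uK).
rewrite (tmap0l (f := \0)) // add0r.
by apply: subtensor_tmap vK; first exact: outM_spQ.
Qed.

Lemma subcoalgebra_spD : subcoalgebra D.
Proof.
move=> c /asboolP[m xT]; rewrite -[c]/(outC M (c, m)) -tmap_outCC.
by apply: subtensor_tmap (hT xT); exact: outC_spD.
Qed.

(** Both factors of Δ(c, 0) lie in the copy of C, so applying [outM] on either side gives 0. Two
    kernel arguments place Δ(c, 0) in K ⊗ K, and [outC] maps [K] into E. *)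
Lemma subcoalgebra_spE : subcoalgebra E.
Proof.
move=> c cT; rewrite -[c](outCK M) -tmap_outCC.
apply: (subtensor_tmap KE KE); apply: (subtensor_kerr TK); last first.
  rewrite tmap_comul_ext (tmap0r _ (g := outM M \o inC M)) //.
  rewrite (tmap0r _ (g := outM M \o inC M)) // outM_inC !raddf0.
  by rewrite !addr0.
apply: (subtensor_kerl TK (hT cT)).
rewrite tmap_comul_ext (tmap0l (f := outM M \o inC M)) //.
rewrite (tmap0l (f := outM M \o inC M)) // outM_inC !raddf0.
by rewrite !addr0.
Qed.

Lemma subbicomodule_spQ : subbicomodule Q.
Proof.
move=> m /asboolP[c xT]; split.
  exact: subtensor_rangel (subcoalgebra_lcoact_spQ xT).
exact: subtensor_ranger (subcoalgebra_rcoact_spQ xT).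
Qed.

(** For (0, m) in [T], p ⊗ p kills Δ(0, m). Applying p on the left first gives an element of D ⊗ T
    killed by id ⊗ p, hence in D ⊗ L; then q on the right puts ρ_l(m) in D ⊗ R. The right coaction
    is symmetric. *)
Lemma subbicomodule_spR : subbicomodule R.
Proof.
move=> m xT; rewrite -[m]outMK -tmap_outCM -tmap_outMC.
have idT : {in T, forall x, @idfun (triv_ext M) x \in T} by [].
split.
  have -> : tmap (outC M) (outM M) (comul (inM M m)) =
      tmap idfun (outM M) (tmap (outC M) idfun (comul (inM M m))).
    by rewrite tmap_comp; apply: eq_tmap.
  apply: (@subtensor_rangel _ _ _ D).
  apply: (subtensor_tmap (A := D) (B := L)) => //; apply: (subtensor_kerr TL).
    by apply: subtensor_tmap (hT xT); first exact: outC_spD.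
  rewrite tmap_comp (eq_tmap (f' := outC M) (g' := outC M)) //.
  by rewrite tmap_outCC outC_inM linear0.
have -> : tmap (outM M) (outC M) (comul (inM M m)) =
    tmap (outM M) idfun (tmap idfun (outC M) (comul (inM M m))).
  by rewrite tmap_comp; apply: eq_tmap.
apply: (@subtensor_ranger _ _ _ _ D).
apply: (subtensor_tmap (A := L) (B := D)) => //; apply: (subtensor_kerl TL).
  by apply: subtensor_tmap (hT xT); last exact: outC_spD.
rewrite tmap_comp (eq_tmap (f' := outC M) (g' := outC M)) //.
by rewrite tmap_outCC outC_inM linear0.
Qed.

(** Both sides of each identity are images of Δ(x), an element of T ⊗ T, under pairs of maps that
    agree on [T]. *)
Lemma bicomod_hom_eta (hD : subcoalgebra D) (hQ : subbicomodule Q)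
    (hR : subbicomodule R) : bicomod_hom
  (eta T : {linear subcoalgebra_bicomod hD -> subquotient_bicomod hQ hR}).
Proof.
apply/bicomod_hom_etaP => x xT; rewrite -tmap_outCM -tmap_outMC -tmap_outCC.
rewrite !tmap_comp; split; apply: (eq_in_tmap _ _ (hT xT)) => // y yT.
  exact/esym/eta_ambientE.
exact/esym/eta_ambientE.
Qed.

End ComponentsOfSubcoalgebra.

(** * A subcoalgebra from conditions (a)-(c) *)

Section SubcoalgebraOfComponents.
Variables (k : fieldType) (C : coalgType k) (M : bicomodType C).
Variable T : submodClosed (triv_ext M).
Let D : submodClosed C := spD T.
Let E : submodClosed C := spE T.
Let Q : submodClosed M := spQ T.
Let R : submodClosed M := spR T.

Lemma eta_ambient_spE : {in E, eta_ambient T =1 \0}.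
Proof.
move=> c cT; rewrite -[c](outCK M) eta_ambientE //.
by rewrite outM_inC linear0.
Qed.

(** This is the lift s of η: [eta_ambient] followed by a quasi-inverse on Q of the projection onto
    M/R. *)
Lemma spD_section : exists s : {linear C -> M},
  {in D, forall c, [/\ s c \in Q, inC M c + inM M (s c) \in T &
                       qproj R (s c) = eta_ambient T c]}.
Proof.
have [g [gQ gE]] := quasi_inverse (qproj R) Q.
exists (g \o eta_ambient T) => c /asboolP[m xT].
have pE : qproj R (g (eta_ambient T c)) = eta_ambient T c.
  rewrite -[c]/(outC M (c, m)) eta_ambientE // gE //.
  exact: outM_spQ.
split=> //; first exact: gQ.
change (inC M c + inM M (g (eta_ambient T c)) \in T).
(* The point (c, s c) is (c, m) minus (0, m - s c), and m - s c lies in R because m and s c both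
   have class η(c). *)
have -> : inC M c + inM M (g (eta_ambient T c)) =
    ((c, m) : triv_ext M) - inM M (m - g (eta_ambient T c)).
  by rewrite [(c, m) in RHS]triv_extE linearB /= opprB addrACA subrr addr0 addrC.
apply: rpredD => //; apply: submod_oppr_closed.
suff : m - g (eta_ambient T c) \in R by [].
by apply/qprojP; rewrite pE -[c]/(outC M (c, m)) eta_ambientE.
Qed.

Hypotheses (hD : subcoalgebra D) (hQ : subbicomodule Q) (hR : subbicomodule R).
Hypothesis comulD : forall c, c \in D ->
  [set x + y | x in subtensor E D & y in subtensor D E] (comul c).
Hypothesis lcoactQ : forall m, m \in Q -> subtensor E Q (lcoact m).
Hypothesis rcoactQ : forall m, m \in Q -> subtensor Q E (rcoact m).
Hypothesis eta_hom : bicomod_hom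
  (eta T : {linear subcoalgebra_bicomod hD -> subquotient_bicomod hQ hR}).

Lemma subcoalgebra_of_eta : subcoalgebra T.
Proof.
move=> x xT; have [s sP] := spD_section.
have [hl hr] := (bicomod_hom_etaP hD hQ hR).1 eta_hom x xT.
have [a aE [b bE ab]] := comulD (outC_spD xT).
have xQ := outM_spQ xT.
have sQ : {in D, forall c, s c \in Q} by move=> c /sP[].
have sE : {in D, qproj R \o s =1 eta_ambient T} by move=> c /sP[].
have RQ : {in Q, forall m, qproj R m = 0 -> m \in R} by move=> m _ /qproj_eq0.
have inCT : {in E, forall c, inC M c \in T} by [].
have inMT : {in R, forall m, inM M m \in T} by [].
(* On [b], in D ⊗ E, id ⊗ η vanishes. Hence id ⊗ π sends both ρ_l(m) and (id ⊗ s) [a] to (id ⊗ η)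
   [a], and their difference lies in E ⊗ R. *)
have [l lR lE] : exists2 l, subtensor E R l &
    lcoact (outM M x) = l + tmap idfun s a.
  exists (lcoact (outM M x) - tmap idfun s a); last by rewrite subrK.
  apply: (subtensor_kerr RQ).
    by apply: subtensorB; [exact: lcoactQ|exact: subtensor_tmap aE].
  rewrite linearB hl -ab tmap_comp (eq_in_tmap (f' := idfun) _ sE aE) // linearD.
  rewrite (eq_in_tmap (t := b) (fun _ _ => erefl) eta_ambient_spE bE).
  by rewrite (tmap0r _ (g := \0)) // addr0 subrr.
(* On this side it is [a] that η ⊗ id kills, its left factor being in E. *)
have [r rR rE] : exists2 r, subtensor R E r &
    rcoact (outM M x) = r + tmap s idfun b.
  exists (rcoact (outM M x) - tmap s idfun b); last by rewrite subrK.
  apply: (subtensor_kerl RQ).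
    by apply: subtensorB; [exact: rcoactQ|exact: subtensor_tmap bE].
  rewrite linearB hr -ab tmap_comp (eq_in_tmap (g' := idfun) sE _ bE) // linearD.
  rewrite (eq_in_tmap (t := a) eta_ambient_spE (fun _ _ => erefl) aE).
  by rewrite (tmap0l (f := \0)) // add0r subrr.
pose sg : {linear C -> triv_ext M} := inC M \+ (inM M \o s).
have sgT : {in D, forall c, sg c \in T} by move=> c /sP[].
have -> : comul x = tmap (inC M) sg a + tmap sg (inC M) b
    + tmap (inC M) (inM M) l + tmap (inM M) (inC M) r.
  rewrite (tmapDr _ (h := sg) (g := inC M) (g' := inM M \o s)) //.
  rewrite (tmapDl _ (h := sg) (f := inC M) (f' := inM M \o s)) //.
  rewrite -[LHS]/(tmap (inC M) (inC M) (comul (outC M x))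
    + tmap (inC M) (inM M) (lcoact (outM M x))
    + tmap (inM M) (inC M) (rcoact (outM M x))).
  rewrite -ab lE rE !linearD.
  rewrite !tmap_comp.
  rewrite (eq_tmap (f := inC M \o idfun) (f' := inC M) (g' := inM M \o s)) //.
  rewrite (eq_tmap (g := inC M \o idfun) (g' := inC M) (f' := inM M \o s)) //.
  (* The terms of [a] and [b] that involve s move next to the matching [inC] terms, which rebuilds
     [sg]; those of [l] and [r] stay last. *)
  by rewrite [LHS](AC ((2*2)*2) (((1*4)*(2*6))*3*5)).
(* Each summand lies in T ⊗ T, since [inC] maps E, [sg] maps D and [inM] maps R into [T]. *)
by do !apply: subtensorD;
  [exact: subtensor_tmap aE|exact: subtensor_tmap bE|
   exact: subtensor_tmap lR|exact: subtensor_tmap rR].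
Qed.

End SubcoalgebraOfComponents.

Theorem corollary4p5 (k : fieldType) (C : coalgType k) (M : bicomodType C)
    (T : submodClosed (triv_ext M)) :
  let D : submodClosed C := spD T in
  let E : submodClosed C := spE T in
  let Q : submodClosed M := spQ T in
  let R : submodClosed M := spR T in
  subcoalgebra T <->
  exists (hE : subcoalgebra E) (hD : subcoalgebra D)
         (hQ : subbicomodule Q) (hR : subbicomodule R),
    [/\ (forall c : C, c \in D ->
           [set x + y | x in subtensor E D & y in subtensor D E] (comul c)),
        (forall m : M, m \in Q -> subtensor E Q (lcoact m)),
        (forall m : M, m \in Q -> subtensor Q E (rcoact m)) &
        bicomod_hom
          (eta T : {linear subcoalgebra_bicomod hD -> subquotient_bicomod hQ hR})].
Proof.
move=> D E Q R; split=> [hT|[_ [hD [hQ [hR [cD lQ rQ h]]]]]]; last first.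
  exact: subcoalgebra_of_eta cD lQ rQ h.
exists (subcoalgebra_spE hT), (subcoalgebra_spD hT).
exists (subbicomodule_spQ hT), (subbicomodule_spR hT); split.
- by move=> c /asboolP[m xT]; apply: (subcoalgebra_comul_spD hT xT).
- by move=> m /asboolP[c xT]; apply: (subcoalgebra_lcoact_spQ hT xT).
- by move=> m /asboolP[c xT]; apply: (subcoalgebra_rcoact_spQ hT xT).
- exact: bicomod_hom_eta.
Qed.
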